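(* The TreeSwap algorithm, when instantiated with a monotone no-external-regret base algorithm, is monotone.
   Context: Full-information online learning with $k$ actions: in each round the algorithm outputs a distribution over actions and then observes the loss vector. An algorithm is monotone if, for any two loss sequences that are identical except that the loss of one action $a$ in one round is decreased, the probability of selecting $a$ in every later round is at least as large under the sequence with the decreased loss. External regret is $\max_i\mathbb E[\sum_t(\ell^t[s^t]-\ell^t[i])]$ where $s^t$ is the selected action; a no-external-regret algorithm has external regret $o(T)$. TreeSwap (Algorithm 1 of Dagan et al.), with horizon $T$, integers $M,d$, $M^{d-1}\le T\le M^d$, and a base full-information algorithm: for every $h\in\{1,\dots,d\}$ and $\sigma\in\{0,\dots,M-1\}^{h-1}$ there is a separate instance $\mathrm{Alg}_\sigma$ of the base algorithm with horizon $M$. In round $t$ let $(\sigma_1,\dots,\sigma_d)$ be the base-$M$ digits of $t-1$. For each $h$, let $x_h^t$ be the distribution output by $\mathrm{Alg}_{(\sigma_1,\dots,\sigma_{h-1})}$ after receiving, for each of its $\sigma_h$ completed blocks of $M^{d-h}$ consecutive rounds, the average loss vector over that block (each instance is thus updated lazily, only at the end of its blocks). TreeSwap plays the uniform mixture $\frac1d\sum_{h=1}^d x_h^t$. *)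

(* Defs.v *)
From HB Require Import structures.
From mathcomp Require Import all_boot all_order all_algebra.
From mathcomp Require Import all_classical all_reals all_analysis.

Set Implicit Arguments.
Unset Strict Implicit.
Unset Printing Implicit Defensive.

Import Order.TTheory GRing.Theory Num.Theory.
Import numFieldNormedType.Exports.

Local Open Scope ring_scope.
Local Open Scope classical_set_scope.

Definition loss (R : realType) (k : nat) := {ffun 'I_k -> R}.

Definition valid_loss (R : realType) (k : nat) (v : loss R k) :=
  forall a, 0 <= v a <= 1.

Record dist (R : realType) (k : nat) := Dist {
  prob :> 'I_k -> R;
  prob_ge0 : forall a, 0 <= prob a;
  prob_sum1 : \sum_a prob a = 1 }.

(* A full-information learner maps the loss vectors observed so far to the
   distribution played in the next round. Rounds are numbered from 0, so the
   learner plays [A (take t l)] in round [t] against the loss sequence [l]. *)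
Definition learner (R : realType) (k : nat) := seq (loss R k) -> dist R k.

(* An algorithm is told its horizon in advance. *)
Definition algorithm (R : realType) (k : nat) := nat -> learner R k.

Definition monotone_learner (R : realType) (k : nat) (T : nat)
    (A : learner R k) :=
  forall (l l' : T.-tuple (loss R k)) (r : 'I_T) (a : 'I_k),
    (forall t, valid_loss (tnth l t)) ->
    (forall t, valid_loss (tnth l' t)) ->
    (forall t, t != r -> tnth l' t = tnth l t) ->
    (forall b, b != a -> tnth l' r b = tnth l r b) ->
    tnth l' r a < tnth l r a ->
  forall t : 'I_T, (r < t)%N -> A (take t l) a <= A (take t l') a.

Definition monotone_algorithm (R : realType) (k : nat) (A : algorithm R k) :=
  forall T, monotone_learner T (A T).

(* Expectation of [f] over the selected actions [s], where [s t] is drawn from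
   the distribution played in round [t], independently across rounds. *)
Definition expect_play (R : realType) (k T : nat) (A : learner R k)
    (l : T.-tuple (loss R k)) (f : {ffun 'I_T -> 'I_k} -> R) : R :=
  \sum_(s : {ffun 'I_T -> 'I_k}) (\prod_(t < T) A (take t l) (s t)) * f s.

(* The supremum is a maximum over the finite set of actions, nonempty because
   [dist R 0] is empty. *)
Definition external_regret (R : realType) (k T : nat) (A : learner R k)
    (l : T.-tuple (loss R k)) : R :=
  sup [set expect_play A l (fun s =>
         \sum_(t < T) (tnth l t (s t) - tnth l t i)) | i in [set: 'I_k]].

Definition worst_external_regret (R : realType) (k T : nat)
    (A : learner R k) : R :=
  sup [set external_regret A l | l in
         [set l : T.-tuple (loss R k) | forall t, valid_loss (tnth l t)]].

Definition no_external_regret (R : realType) (k : nat) (A : algorithm R k) :=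
  (fun T : nat => worst_external_regret T (A T))
    =o_\oo (fun T : nat => T%:R : R).

Section UniformMixture.
Variables (R : realType) (k n : nat) (n_gt0 : (0 < n)%N) (p : 'I_n -> dist R k).

Definition mix_fun (a : 'I_k) : R := n%:R^-1 * \sum_(i < n) p i a.

Lemma mix_ge0 a : 0 <= mix_fun a.
Proof.
by rewrite mulr_ge0 ?invr_ge0 ?ler0n// sumr_ge0// => i _; exact: prob_ge0.
Qed.

Lemma mix_sum1 : \sum_a mix_fun a = 1.
Proof.
rewrite -mulr_sumr exchange_big /= (eq_bigr (fun=> 1)) => [|i _].
  by rewrite sumr_const card_ord mulVf// pnatr_eq0 -lt0n.
exact: prob_sum1.
Qed.

Definition uniform_mixture : dist R k := Dist mix_ge0 mix_sum1.

End UniformMixture.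

(* The [d] base-[M] digits of [t], most significant first. *)
Definition digits (M d t : nat) : seq nat :=
  [seq (t %/ M ^ (d - i.+1) %% M)%N | i <- iota 0 d].

(* First of the [M ^ (d - size tau)] consecutive rounds whose leading digits
   are [tau]. *)
Definition block_start (M d : nat) (tau : seq nat) : nat :=
  (\sum_(i < size tau) nth 0 tau i * M ^ (d - i.+1))%N.

Definition block_average (R : realType) (k M d : nat) (l : seq (loss R k))
    (tau : seq nat) : loss R k :=
  let B := (M ^ (d - size tau))%N in
  [ffun a => B%:R^-1 *
     \sum_(block_start M d tau <= s < block_start M d tau + B)
        (nth 0 l s : loss R k) a].

(* The loss vectors received by the instance at node [sigma] once its first [n]
   blocks are completed; its [j]-th block is the one with leading digits
   [rcons sigma j]. *)
Definition node_history (R : realType) (k M d : nat) (l : seq (loss R k))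
    (sigma : seq nat) (n : nat) : seq (loss R k) :=
  [seq block_average M d l (rcons sigma j) | j <- iota 0 n].

(* Level [h : 'I_d] stands for level [h + 1] of the tree: its instances are
   indexed by the [h] leading digits of the round. The current round is
   [size l], and only blocks completed before it are read from [l]. *)
Definition level_play (R : realType) (k M d : nat) (base : algorithm R k)
    (l : seq (loss R k)) (h : 'I_d) : dist R k :=
  let sigma := digits M d (size l) in
  base M (node_history M d l (take h sigma) (nth 0%N sigma h)).

Definition TreeSwap (R : realType) (k M d : nat) (d_gt0 : (0 < d)%N)
    (base : algorithm R k) : learner R k :=
  fun l => uniform_mixture d_gt0 (level_play M base l).

(* Main.v *)
Require Import Defs.
From mathcomp Require Import all_boot all_order all_algebra.
From mathcomp Require Import all_classical all_reals all_analysis.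

(** Decreasing the loss of [a] in round [r] changes, for each instance of the
    base algorithm, at most the average loss of the one block containing [r],
    and there only by lowering the coordinate [a]; the base algorithm therefore
    gives [a] at least as much weight at every level of the tree, and so does
    the uniform mixture. *)

Set Implicit Arguments.
Unset Strict Implicit.
Unset Printing Implicit Defensive.

Import Order.TTheory GRing.Theory Num.Theory.
Local Open Scope ring_scope.

(** Sequences are total functions and the decrease is weak, so the relation covers equal sequences
    too and passes to block averages, with a block index in place of [r]. *)
Definition lowered (R : realType) (k : nat) (r : nat) (a : 'I_k)
    (f g : nat -> loss R k) :=
  [/\ forall j, j != r -> g j = f j,
      forall b, b != a -> g r b = f r b
    & g r a <= f r a].

Lemma valid_loss0 (R : realType) (k : nat) : valid_loss (0 : loss R k).
Proof. by move=> a; rewrite ffunE lexx ler01. Qed.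

Lemma valid_loss_nth (R : realType) (k T t s : nat)
    (l : T.-tuple (loss R k)) :
  (forall i, valid_loss (tnth l i)) -> valid_loss (nth 0 (take t l) s).
Proof.
move=> vl; have [st|ts] := ltnP s (size (take t l)).
  by have /mem_take/tnthP[i ->] := mem_nth 0 st.
by rewrite nth_default//; exact: valid_loss0.
Qed.

(** From position [t] on both functions return the default [0], so a change in a round [r >= t]
    simply disappears. *)
Lemma lowered_take (R : realType) (k T t : nat) (l l' : T.-tuple (loss R k))
    (r : 'I_T) (a : 'I_k) :
  (forall i, i != r -> tnth l' i = tnth l i) ->
  (forall b, b != a -> tnth l' r b = tnth l r b) ->
  tnth l' r a <= tnth l r a ->
  lowered r a (nth 0 (take t l)) (nth 0 (take t l')).
Proof.
move=> same other low.
have nthT (u : T.-tuple (loss R k)) s :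
    nth 0 (take t u) s = if (s < t)%N then nth 0 u s else 0.
  case: ltnP => st; first by rewrite nth_take.
  by rewrite nth_default// size_take_min geq_min st.
split=> [j jr|b ba|]; rewrite !nthT; case: ifP => // _.
- have [jT|Tj] := ltnP j T; last by rewrite !nth_default ?size_tuple.
  by have := same (Ordinal jT) jr; rewrite !(tnth_nth 0).
- by have := other b ba; rewrite !(tnth_nth 0).
- by move: low; rewrite !(tnth_nth 0).
Qed.

(** Bridges to [monotone_learner], which speaks of full [T]-tuples and strict decreases: if [r >= n]
    or nothing strictly drops, the two prefixes coincide; otherwise both extend to [T]-tuples. *)
Lemma monotone_learner_mkseq (R : realType) (k T : nat) (A : learner R k)
    (n r : nat) (a : 'I_k) (f g : nat -> loss R k) :
  monotone_learner T A -> (n < T)%N ->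
  (forall j, valid_loss (f j)) -> (forall j, valid_loss (g j)) ->
  lowered r a f g ->
  A (mkseq f n) a <= A (mkseq g n) a.
Proof.
move=> mA nT vf vg [same other low].
have [rn|nr] := ltnP r n; last first.
  suff -> : mkseq g n = mkseq f n by [].
  apply/eq_in_map => j; rewrite mem_iota add0n => /andP[_ jn].
  by apply: same; rewrite neq_ltn (leq_trans jn nr).
have [ltgf|legf] := ltP (g r a) (f r a); last first.
  suff -> : mkseq g n = mkseq f n by [].
  apply/eq_map => j; have [->|/same//] := eqVneq j r.
  apply/ffunP => b; have [->|/other//] := eqVneq b a.
  by apply/le_anti; rewrite low legf.
have takeE (h : nat -> loss R k) :
    mkseq h n = take n [tuple h i | i < T].
  rewrite /= -[RHS]/(take n (map (h \o val) (enum 'I_T))) map_comp val_enum_ord.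
  by rewrite -map_take take_iota (minn_idPl (ltnW nT)).
rewrite !takeE.
(* A prefix of length [n] is what the learner has seen in round [n], a genuine round because
   [n < T]. *)
apply: (mA _ _ (Ordinal (ltn_trans rn nT)) a _ _ _ _ _ (Ordinal nT)) => //.
- by move=> i; rewrite tnth_mktuple.
- by move=> i; rewrite tnth_mktuple.
- by move=> i ir; rewrite !tnth_mktuple; exact: same.
- by move=> b ba; rewrite !tnth_mktuple; exact: other.
- by rewrite !tnth_mktuple.
Qed.

Lemma valid_block_average (R : realType) (k M d : nat) (l : seq (loss R k))
    (tau : seq nat) :
  (forall s, valid_loss (nth 0 l s)) -> valid_loss (block_average M d l tau).
Proof.
move=> vl a; rewrite ffunE; set B := (M ^ _)%N.
apply/andP; split.
  by rewrite mulr_ge0 ?invr_ge0 ?ler0n// sumr_ge0// => s _; case/andP: (vl s a).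
(* An empty block, possible when [M = 0], has average [0] since [0^-1 = 0]. *)
have [->|B0] := posnP B; first by rewrite invr0 mul0r ler01.
rewrite mulrC ler_pdivrMr ?ltr0n// mul1r.
apply: (@le_trans _ _
  (\sum_(block_start M d tau <= s < block_start M d tau + B) 1)).
  by apply: ler_sum => s _; case/andP: (vl s a).
by rewrite sumr_const_nat addKn.
Qed.

Lemma block_start_rcons (M d : nat) (tau : seq nat) (j : nat) :
  block_start M d (rcons tau j) =
  (block_start M d tau + j * M ^ (d - (size tau).+1))%N.
Proof.
rewrite /block_start size_rcons big_ord_recr /= nth_rcons ltnn eqxx.
by congr addn; apply: eq_bigr => i _; rewrite nth_rcons ltn_ord.
Qed.

(* When [r] precedes the blocks of the node, the truncated subtraction selects
   block 0, which is then unchanged, and this is allowed by [lowered]. *)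
Lemma lowered_block_average (R : realType) (k M d : nat)
    (l l' : seq (loss R k)) (tau : seq nat) (r : nat) (a : 'I_k) :
  lowered r a (nth 0 l) (nth 0 l') ->
  lowered ((r - block_start M d tau) %/ M ^ (d - (size tau).+1)) a
    (fun j => block_average M d l (rcons tau j))
    (fun j => block_average M d l' (rcons tau j)).
Proof.
move=> [same other low]; split=> [j jr|b ba|].
- apply/ffunP => b; rewrite !ffunE block_start_rcons size_rcons.
  congr (_ * _); apply: eq_big_nat => s /andP[ls sl].
  rewrite same//; apply: contra_neq jr => <-.
  move: ls sl; set B := (M ^ _)%N => ls sl.
  have B0 : (0 < B)%N.
    rewrite -(ltn_add2l (block_start M d tau + j * B)) addn0.
    exact: leq_ltn_trans sl.
  have := subnKC ls; set m := (s - _)%N => sE.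
  have mB : (m < B)%N by move: sl; rewrite -sE ltn_add2l.
  (* The offset of [s] from the start of the node is [j * B + m] with [m < B], so its quotient by
     [B] is [j]. *)
  by rewrite -sE -addnA addKn divnMDl// divn_small// addn0.
(* The two remaining parts compare the averages round by round, whether or not the block contains
   [r]. *)
- rewrite !ffunE; congr (_ * _); apply: eq_bigr => s _.
  by have [->|/same->//] := eqVneq s r; exact: other.
- rewrite !ffunE ler_wpM2l ?invr_ge0 ?ler0n//; apply: ler_sum => s _.
  by have [->//|/same->] := eqVneq s r.
Qed.

Theorem lemma15 (R : realType) (k : nat) (base : algorithm R k)
    (base_monotone : monotone_algorithm base)
    (base_no_regret : no_external_regret base)
    (T M d : nat) (d_gt0 : (0 < d)%N)
    (hT : (M ^ d.-1 <= T <= M ^ d)%N) :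
  monotone_learner T (TreeSwap M d_gt0 base).
Proof.
move=> l l' r a vl vl' same other /ltW low t _.
(* Round [t] exists, so [0 < T <= M ^ d], which excludes [M = 0] as [d > 0]. *)
have M_gt0 : (0 < M)%N.
  case/andP: hT => _ /(leq_trans (ltn_ord t)).
  by case: M => //; rewrite exp0n.
rewrite /= /mix_fun ler_wpM2l ?invr_ge0 ?ler0n//; apply: ler_sum => h _.
have sizeE (u : T.-tuple (loss R k)) : size (take t u) = t.
  by rewrite size_takel// size_tuple ltnW.
rewrite /level_play !sizeE /node_history.
(* The history of a node unfolds to a [mkseq] of block averages; its length is a base-[M] digit,
   hence below the horizon [M] of the instance. *)
apply: (monotone_learner_mkseq (base_monotone M)).
- by rewrite (nth_map 0%N) ?size_iota// ltn_mod.
- by move=> j; apply: valid_block_average => s; exact: valid_loss_nth.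
- by move=> j; apply: valid_block_average => s; exact: valid_loss_nth.
- exact: lowered_block_average (lowered_take t same other low).
Qed.
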